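(* There exists $\delta>0$ such that for every real number $\lambda<-\frac{7}{2\sqrt{2}}+\delta$ there exist an integer $m>2$ and a closed embedded curve in $\mathbb{R}^2$, not a circle, which satisfies $$k=-\langle x,N\rangle+\lambda$$ and whose image has $m$-symmetry.
   Context: For a smooth curve $x(s)\in\mathbb{R}^2$ parametrized by arc length $s$, let $T=\frac{dx}{ds}$ be the unit tangent vector, let $N$ be a continuous choice of unit normal vector along the curve (either of the two rotations of $T$ by $\pm\frac{\pi}{2}$, the same one along the whole curve), and let the curvature $k$ be defined by $\frac{dT}{ds}=kN$. Replacing $N$ by $-N$ changes $k$ to $-k$. A curve is a solution of the equation $k=-\langle x,N\rangle+\lambda$ if the equation holds at every point of the curve for a fixed such choice of $N$. A closed embedded curve is a smooth, regular, simple closed curve. A set in $\mathbb{R}^2$ admits $m$-symmetry ($m$ a positive integer) if it is invariant under the rotation by angle $\frac{2\pi}{m}$ about the origin. *)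

(* Defs.v *)
From Stdlib Require Import Reals.
From Coquelicot Require Import Coquelicot.
Open Scope R_scope.

Definition plane : Type := (R * R)%type.

Definition dot (p q : plane) : R := fst p * fst q + snd p * snd q.

(* Coquelicot's product norm is sqrt (x^2 + y^2), i.e. the Euclidean norm
   of the plane. *)
Definition enorm (p : plane) : R := norm (p : R * R).

Definition rot (theta : R) (p : plane) : plane :=
  (cos theta * fst p - sin theta * snd p,
   sin theta * fst p + cos theta * snd p).

Definition deriv (x : R -> plane) (s : R) : plane :=
  (Derive (fun t => fst (x t)) s, Derive (fun t => snd (x t)) s).

Definition smooth (x : R -> plane) : Prop :=
  forall (n : nat) (s : R),
    ex_derive_n (fun t => fst (x t)) n s /\
    ex_derive_n (fun t => snd (x t)) n s.

Definition regular (x : R -> plane) : Prop :=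
  forall s : R, deriv x s <> (0, 0).

Definition unit_speed (x : R -> plane) : Prop :=
  forall s : R, enorm (deriv x s) = 1.

(* A closed curve is represented by an L-periodic map defined on all of R. *)
Definition closed_curve (x : R -> plane) (L : R) : Prop :=
  0 < L /\ forall s : R, x (s + L) = x s.

Definition simple_closed (x : R -> plane) (L : R) : Prop :=
  closed_curve x L /\
  forall s t : R, 0 <= s < L -> 0 <= t < L -> x s = x t -> s = t.

Definition closed_embedded (x : R -> plane) : Prop :=
  smooth x /\ regular x /\ exists L : R, simple_closed x L.

(* The choice of rotation is made once for the whole curve. *)
Definition unit_normal (x N : R -> plane) : Prop :=
  (forall s : R, N s = rot (PI / 2) (deriv x s)) \/
  (forall s : R, N s = rot (- (PI / 2)) (deriv x s)).

(* For x parametrized by arc length, so that deriv x is the unit tangent. *)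
Definition curvature (x N : R -> plane) (k : R -> R) : Prop :=
  forall s : R, deriv (deriv x) s = (k s * fst (N s), k s * snd (N s)).

Definition is_solution (lambda : R) (x : R -> plane) : Prop :=
  unit_speed x /\
  exists (N : R -> plane) (k : R -> R),
    unit_normal x N /\ curvature x N k /\
    forall s : R, k s = - dot (x s) (N s) + lambda.

Definition image (x : R -> plane) (p : plane) : Prop :=
  exists s : R, x s = p.

Definition is_circle (A : plane -> Prop) : Prop :=
  exists (c : plane) (r : R), 0 < r /\
    forall p : plane, A p <-> enorm (fst p - fst c, snd p - snd c) = r.

Definition admits_symmetry (m : nat) (A : plane -> Prop) : Prop :=
  (0 < m)%nat /\ forall p : plane, A p <-> A (rot (2 * PI / INR m) p).

(* Main.v *)
(* Put lambda = a - 1/a, so that 1/a is the radius of the circle solution with inward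
   normal. With tangent angle th and k_s = p k, the equation becomes
   k_s = p k, p_s = 1 + lambda k - k^2, th_s = k in arc length, and then
   x = p T + (lambda - k) N. Writing k = a e^u, the quantity
   p^2 + a^2 (e^u - 1)^2 + 2 (e^u - 1 - u) = p^2 + H(u)^2 is conserved, where H is smooth and
   increasing, so the orbits are p = B cos phi, H(u) = B sin phi, and the angle by which T turns
   in one oscillation is an integral T(B) over [0, 2 pi] that depends continuously on B >= 0.
   If T(B) = 2 pi / 3, three oscillations close up to a convex curve with 3-symmetry.

   As B -> oo, T(B) -> pi > 2 pi / 3. At B = 0, T = 2 pi a / sqrt (1 + a^2), which is less
   than 2 pi / 3 exactly when a^2 < 1/8, i.e. lambda < -7 / (2 sqrt 2). At a^2 = 1/8 the
   oscillation is hardening, i.e. T decreases for small B, so T(B) < 2 pi / 3 at a fixed small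
   amplitude still holds for a^2 slightly above 1/8. In all cases the intermediate value
   theorem applies. *)
Require Import Defs.
From Stdlib Require Import Reals Lra Lia Psatz ClassicalEpsilon.
From Coquelicot Require Import Coquelicot.
Open Scope R_scope.

(** * The amplitude function *)

Lemma increasing_of_derive (f f' : R -> R) :
  (forall x, is_derive f x (f' x)) -> (forall x, 0 < f' x) ->
  forall x y, x < y -> f x < f y.
Proof.
  intros Hd Hpos x y Hxy.
  destruct (MVT_gen f x y f') as [c [_ Hc]].
  - intros; apply Hd.
  - intros z _. apply continuity_pt_filterlim, (ex_derive_continuous f).
    now exists (f' z).
  - specialize (Hpos c). nra.
Qed.

(** Strict monotonicity gives injectivity, so the preimage picked by choice is a two-sided inverse;
    its continuity and derivative at [y] are local and come from the interval [g y - 1, g y + 1]. It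
    is applied both to the amplitude function and to arc length. *)
Lemma inverse_derive (f f' : R -> R) :
  (forall x, is_derive f x (f' x)) -> (forall x, 0 < f' x) ->
  (forall y, exists x, f x = y) ->
  exists g, (forall y, f (g y) = y) /\ (forall x, g (f x) = x) /\
    forall y, is_derive g y (/ f' (g y)).
Proof.
  intros Hd Hpos Hsurj.
  pose proof (increasing_of_derive f f' Hd Hpos) as Hinc.
  set (g := fun y => proj1_sig (constructive_indefinite_description _ (Hsurj y))).
  assert (Hfg : forall y, f (g y) = y).
  { intros y; unfold g; now destruct constructive_indefinite_description. }
  assert (Hgf : forall x, g (f x) = x).
  { intros x. destruct (Rtotal_order (g (f x)) x) as [H|[H|H]]; auto;
      apply Hinc in H; rewrite Hfg in H; lra. }
  exists g. split; [exact Hfg|]. split; [exact Hgf|].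
  intros y.
  assert (Dpt : forall x, derivable_pt_lim f x (f' x)).
  { intros x; apply is_derive_Reals, Hd. }
  assert (Hb : f (g y - 1) < y < f (g y + 1)).
  { rewrite <- (Hfg y) at 2 3. split; apply Hinc; lra. }
  assert (Hcont : continuity_pt g y).
  { apply (Ranalysis5.continuity_pt_recip_interv f g (g y - 1) (g y + 1)); auto; try lra.
    - intros x _ _; apply Hfg.
    - intros x H1 H2. rewrite <- (Hgf (g y - 1)), <- (Hgf (g y + 1)).
      split; apply Rnot_lt_le; intros H; apply Hinc in H; rewrite !Hfg in H; lra.
    - intros a _. apply derivable_continuous_pt. exists (f' a); apply Dpt. }
  (* Each derivability proof carries the value [f' a], so that [derive_pt] computes to it. *)
  set (Prf := fun a (_ : g (f (g y - 1)) <= a <= g (f (g y + 1))) =>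
    exist _ (f' a) (Dpt a) : derivable_pt f a).
  assert (Hin : g (f (g y - 1)) <= g y <= g (f (g y + 1))) by (rewrite !Hgf; lra).
  apply is_derive_Reals.
  replace (/ f' (g y)) with (1 / derive_pt f (g y) (Prf (g y) Hin)) by (cbn; field; specialize (Hpos (g y)); lra).
  apply (Ranalysis5.derivable_pt_lim_recip_interv f g (f (g y - 1)) (f (g y + 1)) y Prf); auto; try lra.
  - intros; apply Hfg.
  - cbn. specialize (Hpos (g y)); lra.
Qed.

(* The entire functions (e^u - 1) / u and (e^u - 1 - u) / u^2, which make the square root [amp]
   of [energy] differentiable at 0 as well. *)
Definition dexp : R -> R := PSeries (PS_decr_1 (fun n => / INR (Factorial.fact n))).

Definition ddexp : R -> R := PSeries (PS_decr_1 (PS_decr_1 (fun n => / INR (Factorial.fact n)))).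

Lemma CV_radius_exp : CV_radius (fun n => / INR (Factorial.fact n)) = p_infty.
Proof.
  apply CV_radius_infinite_DAlembert.
  - intros n; apply Rinv_neq_0_compat, INR_fact_neq_0.
  - apply is_lim_seq_ext with (fun n => / INR (S n)).
    + intros n. change (Factorial.fact (S n)) with (S n * Factorial.fact n)%nat; rewrite mult_INR.
      pose proof (INR_fact_lt_0 n). pose proof (lt_0_INR (S n) ltac:(lia)).
      rewrite Rabs_pos_eq.
      * field. split; lra.
      * apply Rlt_le, Rdiv_lt_0_compat; apply Rinv_0_lt_compat; nra.
    + apply (is_lim_seq_incr_1 (fun n => / INR n)).
      replace (Finite 0) with (Rbar_inv p_infty) by reflexivity.
      apply is_lim_seq_inv; [apply is_lim_seq_INR | discriminate].
Qed.

Lemma exp_dexp u : exp u = 1 + u * dexp u.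
Proof.
  rewrite exp_Reals, PSeries_decr_1.
  - unfold dexp. cbn. now rewrite Rinv_1.
  - apply CV_radius_inside. now rewrite CV_radius_exp.
Qed.

Lemma dexp_ddexp u : dexp u = 1 + u * ddexp u.
Proof.
  unfold dexp. rewrite PSeries_decr_1.
  - unfold ddexp, PS_decr_1 at 1. cbn. now rewrite Rinv_1.
  - apply CV_radius_inside. now rewrite CV_radius_decr_1, CV_radius_exp.
Qed.

Lemma dexp_0 : dexp 0 = 1.
Proof. rewrite dexp_ddexp. ring. Qed.

Lemma ddexp_0 : ddexp 0 = / 2.
Proof.
  unfold ddexp. rewrite PSeries_0. unfold PS_decr_1. cbn. f_equal.
Qed.

Lemma ex_derive_dexp u : ex_derive dexp u.
Proof. apply ex_derive_PSeries. now rewrite CV_radius_decr_1, CV_radius_exp. Qed.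

Lemma ex_derive_ddexp u : ex_derive ddexp u.
Proof. apply ex_derive_PSeries. now rewrite !CV_radius_decr_1, CV_radius_exp. Qed.

Lemma dexp_pos u : 0 < dexp u.
Proof.
  destruct (Rtotal_order u 0) as [H|[->|H]].
  - pose proof (exp_dexp u). pose proof (exp_increasing _ _ H). rewrite exp_0 in *. nra.
  - rewrite dexp_0; lra.
  - pose proof (exp_dexp u). pose proof (exp_increasing _ _ H). rewrite exp_0 in *. nra.
Qed.

Lemma ddexp_pos u : 0 < ddexp u.
Proof.
  destruct (Req_dec u 0) as [->|H].
  - rewrite ddexp_0; lra.
  - pose proof (exp_dexp u) as H1. rewrite dexp_ddexp in H1. pose proof (exp_ineq1 u H).
    pose proof (Rsqr_pos_lt u H). unfold Rsqr in *. nra.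
Qed.

Lemma Derive_dexp u : u * Derive dexp u = exp u - dexp u.
Proof.
  assert (H : is_derive exp u (dexp u + u * Derive dexp u)).
  { apply is_derive_ext with (fun u => 1 + u * dexp u).
    - intros t; symmetry; apply exp_dexp.
    - auto_derive; [apply ex_derive_dexp|].
      change (Derive (fun x => dexp x)) with (Derive dexp). ring. }
  apply is_derive_unique in H. rewrite (is_derive_unique _ _ _ (is_derive_exp u)) in H. lra.
Qed.

Lemma Derive_ddexp u : Derive dexp u = ddexp u + u * Derive ddexp u.
Proof.
  apply is_derive_unique.
  apply is_derive_ext with (fun u => 1 + u * ddexp u).
  - intros t; symmetry; apply dexp_ddexp.
  - auto_derive; [apply ex_derive_ddexp|].
    change (Derive (fun x => ddexp x)) with (Derive ddexp). ring.
Qed.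

(** Division by u settles u <> 0; at u = 0 both terms on the left equal 1/2. *)
Lemma Derive_dexp_ddexp u : Derive dexp u + ddexp u = dexp u.
Proof.
  destruct (Req_dec u 0) as [->|H].
  - rewrite Derive_ddexp, dexp_0, ddexp_0. lra.
  - apply (Rmult_eq_reg_l u); auto.
    pose proof (Derive_dexp u). pose proof (exp_dexp u). pose proof (dexp_ddexp u). lra.
Qed.

(* Twice the potential: along an orbit, p ^ 2 + energy a u is constant. *)
Definition energy (a u : R) : R :=
  a ^ 2 * (exp u - 1) ^ 2 + 2 * (exp u - 1 - u).

(** This is [energy a u / u ^ 2] extended through 0. It is positive, so [amp], the root of the
    energy carrying the sign of u, is differentiable everywhere. *)
Definition quot (a u : R) : R := a ^ 2 * dexp u ^ 2 + 2 * ddexp u.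

Definition amp (a u : R) : R := u * sqrt (quot a u).

(** Half the derivative of [energy] divided by [amp], with the common factor u cancelled. Along an
    orbit it is the derivative of the phase phi with respect to arc length. *)
Definition amp' (a u : R) : R := dexp u * (1 + a ^ 2 * exp u) / sqrt (quot a u).

Lemma quot_pos a u : 0 < quot a u.
Proof. unfold quot. pose proof (ddexp_pos u). pose proof (pow2_ge_0 a). pose proof (pow2_ge_0 (dexp u)). nra. Qed.

Lemma sqrt_quot_pos a u : 0 < sqrt (quot a u).
Proof. apply sqrt_lt_R0, quot_pos. Qed.

Lemma amp_sqr a u : amp a u ^ 2 = energy a u.
Proof.
  unfold amp, energy. rewrite Rpow_mult_distr, pow2_sqrt by apply Rlt_le, quot_pos.
  unfold quot. rewrite (exp_dexp u).
  replace (1 + u * dexp u - 1 - u) with (u ^ 2 * ddexp u) by (rewrite (dexp_ddexp u); ring). ring.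
Qed.

Lemma is_derive_amp a u : is_derive (amp a) u (amp' a u).
Proof.
  pose proof (quot_pos a u) as Hq. pose proof (sqrt_quot_pos a u) as Hs.
  pose proof (ex_derive_dexp u). pose proof (ex_derive_ddexp u).
  unfold amp, quot in *. auto_derive.
  - repeat split; auto.
  - unfold amp'. fold (quot a u).
    replace (a * (a * 1) * (dexp u * (dexp u * 1)) + 2 * ddexp u) with (quot a u) by (unfold quot; ring).
    fold (quot a u) in *.
    apply (Rmult_eq_reg_r (sqrt (quot a u))); [|lra].
    field_simplify; [|lra|lra]. rewrite pow2_sqrt by lra. unfold quot.
    change (Derive (fun x => dexp x)) with (Derive dexp).
    change (Derive (fun x => ddexp x)) with (Derive ddexp).
    (* These relations eliminate [exp u] and [Derive ddexp u]; the a^2 terms then agree, and the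
       rest is E3. *)
    pose proof (Derive_dexp u) as E1. pose proof (Derive_ddexp u) as E2.
    pose proof (Derive_dexp_ddexp u) as E3.
    replace (exp u) with (dexp u + u * Derive dexp u) by lra.
    replace (u * Derive ddexp u) with (Derive dexp u - ddexp u) by lra.
    transitivity (a ^ 2 * dexp u * (dexp u + u * Derive dexp u) + (ddexp u + (u * Derive ddexp u + ddexp u))); [field|].
    replace (u * Derive ddexp u) with (Derive dexp u - ddexp u) by lra.
    lra.
Qed.

(** * The turning angle of one oscillation *)

Lemma amp'_pos a u : 0 < amp' a u.
Proof.
  unfold amp'. apply Rdiv_lt_0_compat; [|apply sqrt_quot_pos].
  apply Rmult_lt_0_compat; [apply dexp_pos|].
  pose proof (exp_pos u). pose proof (pow2_ge_0 a). nra.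
Qed.

Lemma continuous_amp' a u : continuous (amp' a) u.
Proof.
  apply (ex_derive_continuous (amp' a)).
  pose proof (quot_pos a u). pose proof (sqrt_quot_pos a u).
  pose proof (ex_derive_dexp u). pose proof (ex_derive_ddexp u).
  unfold amp', quot in *. auto_derive.
  replace (a * (a * 1) * (dexp u * (dexp u * 1)) + 2 * ddexp u)
    with (a ^ 2 * dexp u ^ 2 + 2 * ddexp u) by ring.
  repeat split; auto. lra.
Qed.

Lemma amp_amp' a u : amp a u * amp' a u = (exp u - 1) * (1 + a ^ 2 * exp u).
Proof.
  unfold amp, amp'. pose proof (sqrt_quot_pos a u).
  replace (exp u - 1) with (u * dexp u) by (rewrite (exp_dexp u); ring).
  field. lra.
Qed.

Lemma amp_increasing a u v : u < v -> amp a u < amp a v.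
Proof.
  apply (increasing_of_derive _ (amp' a)); intros; [apply is_derive_amp | apply amp'_pos].
Qed.

Lemma amp_0 a : amp a 0 = 0.
Proof. unfold amp; ring. Qed.

(** This is the frequency of the linearized oscillation about the circle solution. *)
Lemma amp'_0 a : amp' a 0 = sqrt (1 + a ^ 2).
Proof.
  unfold amp', quot. rewrite dexp_0, ddexp_0, exp_0.
  replace (a ^ 2 * 1 ^ 2 + 2 * / 2) with (1 + a ^ 2) by field.
  assert (0 < 1 + a ^ 2) by (pose proof (pow2_ge_0 a); lra).
  pose proof (sqrt_lt_R0 _ H). pose proof (sqrt_sqrt (1 + a ^ 2) (Rlt_le _ _ H)) as E.
  replace (1 * (1 + a ^ 2 * 1)) with (sqrt (1 + a ^ 2) * sqrt (1 + a ^ 2)) by lra.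
  field. lra.
Qed.

Lemma exp_minus_1_ge u : 0 <= exp u - 1 - u.
Proof.
  destruct (Req_dec u 0) as [->|H]; [rewrite exp_0; lra|].
  pose proof (exp_ineq1 u H); lra.
Qed.

Lemma amp_sqr_ge a u : (a * (exp u - 1)) ^ 2 <= amp a u ^ 2.
Proof. rewrite amp_sqr. unfold energy. pose proof (exp_minus_1_ge u). nra. Qed.

(** By the intermediate value theorem: to the right a (e^u - 1) >= a u makes [amp] reach |y|, and to
    the left the term - 2 u makes the energy at least 2 y^2. *)
Lemma amp_surjective a y : 0 < a -> exists u, amp a u = y.
Proof.
  intros Ha.
  assert (Hp : y <= amp a (Rabs y / a)).
  { assert (H0 : 0 <= Rabs y / a).
    { apply Rdiv_le_0_compat; [apply Rabs_pos | exact Ha]. }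
    apply Rle_trans with (1 := Rle_abs y), Rsqr_incr_0_var.
    - pose proof (amp_sqr_ge a (Rabs y / a)). pose proof (exp_minus_1_ge (Rabs y / a)).
      assert (Rabs y = a * (Rabs y / a)) by (field; lra).
      unfold Rsqr. assert (Rabs y <= a * (exp (Rabs y / a) - 1)) by nra.
      pose proof (Rabs_pos y). nra.
    - unfold amp. pose proof (sqrt_quot_pos a (Rabs y / a)). nra. }
  assert (Hm : amp a (- (1 + y ^ 2)) <= y).
  { set (u := - (1 + y ^ 2)).
    assert (Hu : u < 0) by (unfold u; pose proof (pow2_ge_0 y); lra).
    assert (amp a u < 0) by (rewrite <- (amp_0 a); now apply amp_increasing).
    pose proof (amp_sqr a u) as H1. unfold energy in H1.
    pose proof (exp_pos u). pose proof (pow2_ge_0 (a * (exp u - 1))).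
    assert (2 * y ^ 2 <= amp a u ^ 2) by (rewrite H1; unfold u in *; nra).
    nra. }
  destruct (IVT_gen (amp a) (- (1 + y ^ 2)) (Rabs y / a) y) as [u [_ Hu]]; [| |eauto].
  - intros u. apply continuity_pt_filterlim, (ex_derive_continuous (amp a)).
    exists (amp' a u). apply is_derive_amp.
  - split; [apply Rle_trans with (2 := Hm), Rmin_l | apply Rle_trans with (1 := Hp), Rmax_r].
Qed.

Definition amp_inverse (a : R) (g : R -> R) : Prop :=
  (forall z, amp a (g z) = z) /\ forall z, is_derive g z (/ amp' a (g z)).

Lemma amp_inverse_exists a : 0 < a -> exists g, amp_inverse a g.
Proof.
  intros Ha.
  destruct (inverse_derive (amp a) (amp' a)) as (g & H1 & _ & H2).
  - apply is_derive_amp.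
  - apply amp'_pos.
  - intros y; now apply amp_surjective.
  - exists g; now split.
Qed.

Lemma amp_inverse_0 a g : amp_inverse a g -> g 0 = 0.
Proof.
  intros [Hg _]. destruct (Rtotal_order (g 0) 0) as [H|[H|H]]; auto;
    apply (amp_increasing a) in H; rewrite Hg, amp_0 in H; lra.
Qed.

(** The derivative of the tangent angle with respect to the phase: k = a e^u divided by the phase
    speed [amp'], at z = B sin phi. *)
Definition rate (a : R) (g : R -> R) (z : R) : R := a * exp (g z) / amp' a (g z).

Lemma continuous_inv_amp' a g z : amp_inverse a g ->
  continuous (fun z => / amp' a (g z)) z.
Proof.
  intros [_ Hg].
  apply continuous_comp with (f := fun z => amp' a (g z)) (g := Rinv).
  - apply continuous_comp with (g := amp' a); [|apply continuous_amp'].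
    apply (ex_derive_continuous g). eexists; apply Hg.
  - apply continuous_Rinv. pose proof (amp'_pos a (g z)); lra.
Qed.

Lemma continuous_rate a g z : amp_inverse a g -> continuous (rate a g) z.
Proof.
  intros H. apply (continuous_mult (fun z => a * exp (g z)) (fun z => / amp' a (g z))).
  - destruct H as [_ Hg]. apply (ex_derive_continuous (fun z => a * exp (g z))).
    assert (ex_derive g z) by (eexists; apply Hg). auto_derive. auto.
  - now apply continuous_inv_amp'.
Qed.

Lemma rate_pos a g z : 0 < a -> 0 < rate a g z.
Proof.
  intros Ha. apply Rdiv_lt_0_compat; [|apply amp'_pos].
  apply Rmult_lt_0_compat; [auto|apply exp_pos].
Qed.

Lemma rate_0 a g : amp_inverse a g -> rate a g 0 = a / sqrt (1 + a ^ 2).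
Proof.
  intros Hg. unfold rate. rewrite (amp_inverse_0 a g Hg), amp'_0, exp_0. f_equal. ring.
Qed.

(** A form free of the square root in [amp'], obtained by multiplying with [amp] times [amp']. It
    determines the rate only away from g z = 0. *)
Lemma rate_eq a g z : amp_inverse a g ->
  rate a g z * ((exp (g z) - 1) * (1 + a ^ 2 * exp (g z))) = a * z * exp (g z).
Proof.
  intros [Hg _]. rewrite <- amp_amp', Hg. unfold rate.
  pose proof (amp'_pos a (g z)). field. lra.
Qed.

Definition period (a : R) (g : R -> R) (B : R) : R :=
  RInt (fun phi => rate a g (B * sin phi)) 0 (2 * PI).

Lemma continuous_comp_sin (f : R -> R) B x : (forall z, continuous f z) ->
  continuous (fun phi => f (B * sin phi)) x.
Proof.
  intros Hf. apply (continuous_comp (fun phi => B * sin phi) f); [|apply Hf].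
  apply (ex_derive_continuous (fun phi => B * sin phi)). auto_derive. auto.
Qed.

Lemma ex_RInt_comp_sin (f : R -> R) B x y : (forall z, continuous f z) ->
  ex_RInt (fun phi => f (B * sin phi)) x y.
Proof.
  intros Hf. apply (@ex_RInt_continuous R_CompleteNormedModule). intros z _.
  now apply continuous_comp_sin.
Qed.

(** Uniform continuity of f on [-(|B| + 1), |B| + 1], which contains C sin phi for all C within 1 of
    B, makes the integrands uniformly close. *)
Lemma continuity_RInt_comp_sin (f : R -> R) : (forall z, continuous f z) ->
  continuity (fun B => RInt (fun phi => f (B * sin phi)) 0 (2 * PI)).
Proof.
  intros Hf B eps Heps.
  pose proof PI_RGT_0 as HPI.
  assert (He : 0 < eps / (4 * PI)) by (apply Rdiv_lt_0_compat; lra).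
  destruct (@Heine_cor2 f (- (Rabs B + 1)) (Rabs B + 1)) with (eps := mkposreal _ He) as [d Hd].
  { intros x _. apply continuity_pt_filterlim, Hf. }
  exists (Rmin d 1). split; [apply Rmin_pos; [apply d | lra]|].
  intros C [_ HC]. cbn in HC |- *. unfold R_dist, Rdist in *.
  assert (HCd : Rabs (C - B) < d) by (eapply Rlt_le_trans; [exact HC | apply Rmin_l]).
  assert (HC1 : Rabs (C - B) < 1) by (eapply Rlt_le_trans; [exact HC | apply Rmin_r]).
  replace (_ - _) with (RInt (fun phi => minus (f (C * sin phi)) (f (B * sin phi))) 0 (2 * PI))
    by (apply (@RInt_minus R_CompleteNormedModule); now apply ex_RInt_comp_sin).
  apply Rle_lt_trans with ((2 * PI - 0) * (eps / (4 * PI))).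
  2:{ replace ((2 * PI - 0) * (eps / (4 * PI))) with (eps / 2) by (field; lra). lra. }
  apply (abs_RInt_le_const (fun phi => minus (f (C * sin phi)) (f (B * sin phi)))); [lra| |].
  - apply (@ex_RInt_minus R_NormedModule); now apply ex_RInt_comp_sin.
  - intros t _. apply Rlt_le.
    assert (Hs : Rabs (sin t) <= 1) by (apply Rabs_le, SIN_bound).
    assert (HCB : Rabs C <= Rabs B + 1).
    { pose proof (Rabs_triang_inv C B). lra. }
    assert (Hm : forall D, Rabs D <= Rabs B + 1 -> - (Rabs B + 1) <= D * sin t <= Rabs B + 1).
    { intros D HD. apply Rabs_le_between. rewrite Rabs_mult.
      pose proof (Rabs_pos D). pose proof (Rabs_pos (sin t)). nra. }
    apply (Hd (C * sin t) (B * sin t)).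
    + now apply Hm.
    + apply Hm. lra.
    + rewrite <- Rmult_minus_distr_r, Rabs_mult. pose proof (Rabs_pos (C - B)). pose proof (Rabs_pos (sin t)). nra.
Qed.

(** With k now denoting e^u, the bound z >= a (k - 1) turns [rate_eq] into rate >= a^2 k / (1 + a^2
    k), which tends to 1. The threshold [u1] makes a^2 k at least 9, hence the ratio at least
    9/10. *)
Lemma rate_large a g : 0 < a -> amp_inverse a g ->
  exists Z, 0 < Z /\ forall z, Z <= z -> 9 / 10 <= rate a g z.
Proof.
  intros Ha Hg.
  set (u1 := ln (1 + 9 / a ^ 2)).
  assert (H9 : 0 < 9 / a ^ 2) by (apply Rdiv_lt_0_compat; [lra | now apply pow_lt]).
  exists (amp a u1). split.
  { rewrite <- (amp_0 a). apply amp_increasing. rewrite <- ln_1. apply ln_increasing; lra. }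
  intros z Hz. pose proof (rate_eq a g z Hg) as E. pose proof (amp_sqr_ge a (g z)) as S.
  rewrite (proj1 Hg z) in S.
  assert (Hu : u1 <= g z).
  { apply Rnot_lt_le; intros H. apply (amp_increasing a) in H. rewrite (proj1 Hg z) in H. lra. }
  set (k := exp (g z)) in *. set (w := rate a g z) in *.
  assert (Hk : 1 + 9 / a ^ 2 <= k).
  { unfold k. rewrite <- (exp_ln (1 + 9 / a ^ 2)) by lra. apply Rnot_lt_le; intros H.
    apply exp_lt_inv in H. fold u1 in H. lra. }
  assert (Hak : 9 + a ^ 2 <= a ^ 2 * k).
  { replace (9 + a ^ 2) with (a ^ 2 * (1 + 9 / a ^ 2)) by (field; lra).
    apply Rmult_le_compat_l; [apply pow2_ge_0 | exact Hk]. }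
  assert (Hz0 : 0 <= z).
  { rewrite <- (proj1 Hg z), <- (amp_0 a). left. apply amp_increasing.
    assert (0 < u1) by (unfold u1; rewrite <- ln_1; apply ln_increasing; lra). lra. }
  assert (Haz : a * (k - 1) <= z).
  { apply Rsqr_incr_0_var; [unfold Rsqr; nra | exact Hz0]. }
  pose proof (pow_lt a 2 Ha) as Ha2.
  assert (Hd : 0 < (k - 1) * (1 + a ^ 2 * k)) by (apply Rmult_lt_0_compat; lra).
  apply (Rmult_le_reg_r _ _ _ Hd). rewrite E.
  assert (Hk1 : 0 <= k - 1) by nra.
  apply Rle_trans with ((k - 1) * (a ^ 2 * k)); [nra|].
  replace ((k - 1) * (a ^ 2 * k)) with (a * k * (a * (k - 1))) by ring.
  replace (a * z * k) with (a * k * z) by ring.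
  apply Rmult_le_compat_l; [nra | exact Haz].
Qed.

(** On [PI/12, 11 PI/12] the argument B sin phi exceeds the threshold, so this arc alone contributes
    at least 9/10 * 5 PI/6 = 3 PI/4 > 2 PI/3; the remaining integrand is positive. *)
Lemma period_large a g : 0 < a -> amp_inverse a g ->
  exists Z, forall B, Z <= B -> 2 * PI / 3 < period a g B.
Proof.
  intros Ha Hg. pose proof PI_RGT_0 as HPI.
  destruct (rate_large a g Ha Hg) as (Z & HZ & Hrate).
  assert (Hs : 0 < sin (PI / 12)) by (apply sin_gt_0; lra).
  exists (Z / sin (PI / 12)). intros B HB.
  assert (HB' : Z <= B * sin (PI / 12)).
  { apply (Rmult_le_compat_r (sin (PI / 12))) in HB; [|lra].
    replace (Z / sin (PI / 12) * sin (PI / 12)) with Z in HB by (field; lra). exact HB. }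
  assert (HB0 : 0 < B) by nra.
  set (f := fun phi => rate a g (B * sin phi)).
  assert (Hex : forall x y, ex_RInt f x y).
  { intros; apply ex_RInt_comp_sin. intros; now apply continuous_rate. }
  assert (Hpos : forall x y, x <= y -> 0 <= RInt f x y).
  { intros x y Hxy. apply RInt_ge_0; auto. intros; apply Rlt_le, rate_pos, Ha. }
  unfold period. fold f.
  rewrite <- (RInt_Chasles f 0 (PI / 12)), <- (RInt_Chasles f (PI / 12) (11 * PI / 12)) by auto.
  change plus with Rplus.
  assert (Hmid : RInt (fun _ => 9 / 10) (PI / 12) (11 * PI / 12) <= RInt f (PI / 12) (11 * PI / 12)).
  { apply RInt_le; auto; [lra | apply ex_RInt_const |].
    intros x Hx. apply Hrate.
    assert (sin (PI / 12) <= sin x).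
    { destruct (Rle_dec x (PI / 2)).
      - apply sin_incr_1; lra.
      - rewrite <- (sin_PI_x x). apply sin_incr_1; lra. }
    nra. }
  rewrite RInt_const in Hmid. change scal with Rmult in Hmid. change mult with Rmult in Hmid.
  pose proof (Hpos 0 (PI / 12) ltac:(lra)). pose proof (Hpos (11 * PI / 12) (2 * PI) ltac:(lra)).
  cbn in *. lra.
Qed.

Lemma period_0 a g : amp_inverse a g -> period a g 0 = 2 * PI * (a / sqrt (1 + a ^ 2)).
Proof.
  intros Hg. unfold period.
  rewrite (RInt_ext _ (fun _ => a / sqrt (1 + a ^ 2))).
  - rewrite RInt_const. change scal with Rmult. cbn. unfold mult; cbn. ring.
  - intros x _. rewrite Rmult_0_l. now apply rate_0.
Qed.

(** * Small oscillations *)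

(** 251/500 slightly exceeds the Taylor coefficient 1/2, so the difference of the two sides, zero at
    v = 0, has a derivative with the sign of v. *)
Lemma ln_1_plus_ge v : - (1 / 2000) <= v <= 1 / 2000 ->
  2 * (v - ln (1 + v)) <= v ^ 2 - 2 / 3 * v ^ 3 + 251 / 500 * v ^ 4.
Proof.
  intros Hv.
  set (f := fun v => v ^ 2 - 2 / 3 * v ^ 3 + 251 / 500 * v ^ 4 - 2 * (v - ln (1 + v))).
  set (df := fun v => v ^ 3 * (1 / 125 + 251 / 125 * v) / (1 + v)).
  assert (Hd : forall x, - (1 / 2000) <= x <= 1 / 2000 -> is_derive f x (df x)).
  { intros x Hx. unfold f, df. auto_derive; [lra|]. field. lra. }
  assert (Hmm : - (1 / 2000) <= Rmin 0 v /\ Rmax 0 v <= 1 / 2000).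
  { split; [apply Rmin_glb | apply Rmax_lub]; lra. }
  destruct (MVT_gen f 0 v df) as (c & Hc & E).
  - intros x Hx. apply Hd. lra.
  - intros x Hx. apply continuity_pt_filterlim, (ex_derive_continuous f).
    exists (df x). apply Hd. lra.
  - assert (Hf0 : f 0 = 0) by (unfold f; rewrite Rplus_0_r, ln_1; ring).
    assert (Hcv : 0 <= c * v).
    { unfold Rmin, Rmax in Hc. destruct (Rle_dec 0 v); nra. }
    assert (H : 0 <= df c * (v - 0)).
    { unfold df.
      replace (c ^ 3 * (1 / 125 + 251 / 125 * c) / (1 + c) * (v - 0))
        with (c ^ 2 * (c * v) * ((1 / 125 + 251 / 125 * c) / (1 + c))) by (field; lra).
      apply Rmult_le_pos; [apply Rmult_le_pos; [apply pow2_ge_0 | exact Hcv]|].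
      apply Rdiv_le_0_compat; lra. }
    unfold f in *. lra.
Qed.

(* In normalized variables, with v = e^u - 1, n = 1 + a^2 and rho = 1/n, the energy is
   y^2 = (1 - rho) v^2 + 2 rho (v - ln (1 + v)), and y = v - rho/3 v^2 + (rho/4 - rho^2/18) v^3 + ...;
   181/1000 slightly exceeds the cubic coefficient at rho = 8/9. *)
Lemma amplitude_cubic_bound rho v : 888 / 1000 <= rho <= 8 / 9 -> - (1 / 2000) <= v <= 1 / 2000 ->
  (1 - rho) * v ^ 2 + rho * (v ^ 2 - 2 / 3 * v ^ 3 + 251 / 500 * v ^ 4)
  <= (v * (1 - rho / 3 * v + 181 / 1000 * v ^ 2)) ^ 2.
Proof.
  intros Hr Hv.
  assert (H : 0 <= v ^ 4 * (rho ^ 2 / 9 + 362 / 1000 - 251 / 500 * rho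
    - 362 / 3000 * rho * v + (181 / 1000) ^ 2 * v ^ 2)).
  { apply Rmult_le_pos; [replace (v ^ 4) with ((v ^ 2) ^ 2) by ring; apply pow2_ge_0|].
    assert (- (1 / 2000) <= rho * v <= 1 / 2000) by (split; nra). assert (0 <= v ^ 2) by apply pow2_ge_0.
    assert (3 / 1000 <= rho ^ 2 / 9 + 362 / 1000 - 251 / 500 * rho) by nra. lra. }
  nra.
Qed.

(** The bound on the normalized rate at the extreme value y = v S, with denominators cleared. The
    terms of order 0 and 1 in v cancel, and the v^2 coefficient is about rho - 8/9 rho^2 - 184/1000
    > 0. *)
Lemma cubic_rate_bound rho v : 888 / 1000 <= rho <= 8 / 9 -> - (1 / 2000) <= v <= 1 / 2000 ->
  let S := 1 - rho / 3 * v + 181 / 1000 * v ^ 2 in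
  S * (1 + v) <= (1 + (1 - rho) * v) * (1 + 2 * rho / 3 * (v * S) - 3 / 1000 * (v * S) ^ 2).
Proof.
  intros Hr Hv S.
  assert (HS : 1 / 2 <= S <= 1 + 3 / 10000).
  { unfold S. assert (- (1 / 2000) <= rho * v <= 1 / 2000) by (split; nra).
    assert (0 <= v ^ 2 <= 1 / 4000000) by nra. lra. }
  assert (HS2 : S ^ 2 <= 1001 / 1000) by nra.
  assert (E : (1 + (1 - rho) * v) * (1 + 2 * rho / 3 * (v * S) - 3 / 1000 * (v * S) ^ 2) - S * (1 + v)
    = v ^ 2 * (rho - 8 / 9 * rho ^ 2 - 181 / 1000 - 3 / 1000 * S ^ 2 - v * S * (1 - rho) * 3 / 1000 * S
       + v * (2 * rho / 3 * (181 / 1000) - 2 * rho ^ 2 / 9 * (1 - rho) - 181 / 1000)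
       + v ^ 2 * (2 * rho / 3 * (1 - rho) * (181 / 1000)))).
  { unfold S. field. }
  assert (0 <= rho - 8 / 9 * rho ^ 2 - 181 / 1000 - 3 / 1000 * S ^ 2 - v * S * (1 - rho) * 3 / 1000 * S
       + v * (2 * rho / 3 * (181 / 1000) - 2 * rho ^ 2 / 9 * (1 - rho) - 181 / 1000)
       + v ^ 2 * (2 * rho / 3 * (1 - rho) * (181 / 1000))).
  { set (t := 2 * rho / 3 * (181 / 1000) - 2 * rho ^ 2 / 9 * (1 - rho) - 181 / 1000).
    assert (- (1 / 5) <= t <= 0) by (unfold t; nra).
    assert (- (1 / 10000) <= v * t) by nra.
    assert (0 <= v ^ 2 * (2 * rho / 3 * (1 - rho) * (181 / 1000))).
    { apply Rmult_le_pos; [apply pow2_ge_0|]. nra. }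
    assert (v * S * (1 - rho) * 3 / 1000 * S <= 1 / 10000).
    { assert (Hw : 0 <= (1 - rho) * S ^ 2 <= 1).
      { pose proof (pow2_ge_0 S). split; nra. }
      replace (v * S * (1 - rho) * 3 / 1000 * S) with (v * ((1 - rho) * S ^ 2) * 3 / 1000) by field.
      nra. }
    (* The right side decreases in rho here and is about 0.00256 at 8/9; the remaining corrections
       stay below 0.0003. *)
    assert (2500 / 1000000 <= rho - 8 / 9 * rho ^ 2 - 184 / 1000) by nra.
    lra. }
  pose proof (pow2_ge_0 v). nra.
Qed.

(* The term in y integrates to 0 over an oscillation, so the sign of the y^2 coefficient makes
   the turning angle decrease; its exact value at y = 0 is rho (10 rho - 9) / 12 < 0. *)
Lemma rate_normalized_le rho v y q : 888 / 1000 <= rho <= 8 / 9 -> - (1 / 2000) <= v <= 1 / 2000 ->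
  0 < v * y ->
  y ^ 2 <= (v * (1 - rho / 3 * v + 181 / 1000 * v ^ 2)) ^ 2 ->
  q * (v * (1 + (1 - rho) * v)) = y * (1 + v) ->
  q <= 1 + 2 * rho / 3 * y - 3 / 1000 * y ^ 2.
Proof.
  intros Hr Hv Hvy HyY Hq.
  pose proof (cubic_rate_bound rho v Hr Hv) as H2. cbv zeta in H2.
  set (S := 1 - rho / 3 * v + 181 / 1000 * v ^ 2) in *.
  assert (HS : 1 / 2 <= S <= 2).
  { unfold S. assert (- (1 / 2000) <= rho * v <= 1 / 2000) by (split; nra).
    assert (0 <= v ^ 2 <= 1 / 4000000) by nra. lra. }
  set (Y := v * S) in *.
  assert (HY : 0 <= v * (Y - y)).
  { assert (0 < v * v) by nra.
    assert (0 < v * Y) by (unfold Y; nra).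
    destruct (Rlt_le_dec 0 v) as [Hv0|Hv0].
    - assert (0 < y) by nra. assert (0 < Y) by nra. nra.
    - assert (v < 0) by nra. assert (y < 0) by nra. assert (Y < 0) by nra. nra. }
  assert (HYb : - (1 / 1000) <= Y <= 1 / 1000) by (unfold Y; split; nra).
  assert (Hyb : - (1 / 1000) <= y <= 1 / 1000) by (split; nra).
  set (t := 1 + (1 - rho) * v) in *.
  assert (Ht : 1 / 2 <= t <= 2) by (unfold t; split; nra).
  (* Replacing [Y] by y in the cleared inequality adds v (Y - y) times this factor to the margin. *)
  assert (Hm : 0 <= 1 + v - v * (t * (2 * rho / 3 - 3 / 1000 * (Y + y)))).
  { set (m := 2 * rho / 3 - 3 / 1000 * (Y + y)).
    assert (0 <= m <= 1) by (unfold m; lra).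
    assert (0 <= t * m <= 2) by nra. nra. }
  apply Rmult_le_reg_r with (v ^ 2 * t); [apply Rmult_lt_0_compat; nra|].
  replace (q * (v ^ 2 * t)) with (v * (y * (1 + v))) by (rewrite <- Hq; ring).
  assert (H : 0 <= v ^ 2 * (t * (1 + 2 * rho / 3 * Y - 3 / 1000 * Y ^ 2) - S * (1 + v))).
  { apply Rmult_le_pos; [apply pow2_ge_0 | lra]. }
  replace (v ^ 2 * (t * (1 + 2 * rho / 3 * Y - 3 / 1000 * Y ^ 2) - S * (1 + v)))
    with (v ^ 2 * t * (1 + 2 * rho / 3 * Y - 3 / 1000 * Y ^ 2) - v * Y * (1 + v)) in H
    by (unfold Y; ring).
  pose proof (Rmult_le_pos _ _ HY Hm). lra.
Qed.

(** Rescaling by y = z / sqrt n and q = rate * sqrt n / a, with n = 1 + a^2, reduces this to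
    [rate_normalized_le]; 1/500 is admissible because n / 500 <= 3/1000. *)
Lemma rate_le a g z : 0 < a -> amp_inverse a g ->
  1 / 8 <= a ^ 2 <= 1 / 8 + / 10 ^ 12 -> - (1 / 6000) <= z <= 1 / 6000 ->
  rate a g z <= a / sqrt (1 + a ^ 2) *
    (1 + 2 / (3 * (1 + a ^ 2) * sqrt (1 + a ^ 2)) * z - z ^ 2 / 500).
Proof.
  intros Ha Hg Ha2 Hz.
  pose proof (rate_eq a g z Hg) as E. pose proof (amp_sqr a (g z)) as Ez.
  pose proof (amp_sqr_ge a (g z)) as Hzv.
  rewrite (proj1 Hg z) in Ez, Hzv. unfold energy in Ez.
  set (u := g z) in *. set (n := 1 + a ^ 2) in *. set (r := sqrt n).
  assert (Hn : 9 / 8 <= n <= 9 / 8 + / 10 ^ 12) by (unfold n; lra).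
  assert (Hr : 0 < r) by (apply sqrt_lt_R0; lra).
  assert (Hrr : r * r = n) by (apply sqrt_sqrt; lra).
  (* At u = 0 [rate_eq] degenerates to 0 = 0, so the known value of the rate at 0 is used. *)
  destruct (Req_dec u 0) as [Hu|Hu].
  { assert (z = 0) as ->.
    { rewrite <- (proj1 Hg z). fold u. rewrite Hu. apply amp_0. }
    rewrite rate_0 by exact Hg. fold n r. apply Req_le. field. split; lra. }
  set (v := exp u - 1) in *.
  assert (Hexp : exp u = 1 + v) by (unfold v; ring). rewrite Hexp in E.
  (* From a^2 v^2 <= z^2 and a^2 >= 1/8 follows v^2 <= 8 / 6000^2 < 1 / 2000^2. *)
  assert (Hv : - (1 / 2000) <= v <= 1 / 2000).
  { assert (v ^ 2 <= 1 / 4000000) by nra. split; nra. }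
  assert (Hln : u = ln (1 + v)) by (rewrite <- Hexp; now rewrite ln_exp).
  pose proof (ln_1_plus_ge v Hv) as Hl. rewrite <- Hln in Hl.
  assert (Hvz : 0 < v * z).
  { rewrite <- (proj1 Hg z). fold u. unfold v.
    destruct (Rtotal_order u 0) as [H|[H|H]]; [|lra|];
    pose proof (amp_increasing a _ _ H) as H1; pose proof (exp_increasing _ _ H) as H3;
    rewrite amp_0 in H1; rewrite exp_0 in H3; nra. }
  set (rho := / n).
  assert (Hnr : n * rho = 1) by (unfold rho; field; lra).
  assert (Hrho : 888 / 1000 <= rho <= 8 / 9) by (split; nra).
  set (y := z / r). set (q := rate a g z * r / a).
  assert (Hzy : z = r * y) by (unfold y; field; lra).
  assert (Hq : q <= 1 + 2 * rho / 3 * y - 3 / 1000 * y ^ 2).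
  { apply rate_normalized_le with v; auto.
    - unfold y. replace (v * (z / r)) with (v * z / r) by (field; lra).
      now apply Rdiv_lt_0_compat.
    - apply Rle_trans with (2 := amplitude_cubic_bound rho v Hrho Hv).
      replace (y ^ 2) with (rho * z ^ 2) by (unfold rho, y; rewrite <- Hrr; field; lra).
      rewrite Ez.
      replace (rho * (a ^ 2 * v ^ 2 + 2 * (v - u))) with ((1 - rho) * v ^ 2 + rho * (2 * (v - u))).
      + apply Rplus_le_compat_l, Rmult_le_compat_l; lra.
      + unfold n in Hnr. replace (a ^ 2) with (n - 1) by (unfold n; ring).
        replace ((1 - rho) * v ^ 2) with ((n * rho - rho) * v ^ 2) by (unfold n; rewrite Hnr; ring). ring.
    - unfold q. apply (Rmult_eq_reg_r (a * n)); [|nra].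
      replace (rate a g z * r / a * (v * (1 + (1 - rho) * v)) * (a * n))
        with (r * (rate a g z * (v * (n + (n - n * rho) * v)))) by (field; lra).
      replace (n + (n - n * rho) * v) with (1 + a ^ 2 * (1 + v)) by (rewrite Hnr; unfold n; ring).
      rewrite E, Hzy, <- Hrr. ring. }
  replace (rate a g z) with (a / r * q) by (unfold q; field; lra).
  apply Rmult_le_compat_l; [apply Rlt_le, Rdiv_lt_0_compat; lra|].
  apply Rle_trans with (1 := Hq).
  replace (2 / (3 * n * r) * z) with (2 * rho / 3 * y) by (unfold rho, y; field; lra).
  assert (0 <= y ^ 2) by apply pow2_ge_0.
  replace (z ^ 2) with (n * y ^ 2) by (rewrite Hzy, <- Hrr; ring). nra.
Qed.

Lemma RInt_quadratic_sin c d :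
  is_RInt (fun phi => 1 + c * sin phi - d * sin phi ^ 2) 0 (2 * PI) (2 * PI - d * PI).
Proof.
  set (F := fun phi => phi - c * cos phi - d * (phi / 2 - sin phi * cos phi / 2)).
  replace (2 * PI - d * PI) with (minus (F (2 * PI)) (F 0)).
  - apply (@is_RInt_derive R_CompleteNormedModule).
    + intros x _. unfold F. auto_derive; auto.
      pose proof (sin2_cos2 x) as H. unfold Rsqr in H.
      replace 1 with (sin x * sin x + cos x * cos x) at 1 by lra.
      transitivity (1 + c * sin x - d * (sin x * sin x + cos x * cos x - cos x * cos x)); [|ring].
      rewrite H at 1. field_simplify.
      replace (cos x ^ 2) with (1 - sin x ^ 2) by lra. field.
    + intros x _. apply (ex_derive_continuous (fun phi => 1 + c * sin phi - d * sin phi ^ 2)).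
      auto_derive. auto.
  - unfold F, minus, plus, opp; cbn. rewrite cos_2PI, sin_2PI, cos_0, sin_0. field.
Qed.

(** Integrating [rate_le] over an oscillation kills the linear term, while the quadratic one lowers
    the linearized turning angle by the factor 1 - d/2. This gain outweighs the excess of a^2 over
    1/8. *)
Lemma period_small a g : 0 < a -> amp_inverse a g ->
  1 / 8 <= a ^ 2 <= 1 / 8 + / 10 ^ 12 -> period a g (1 / 6000) < 2 * PI / 3.
Proof.
  intros Ha Hg Ha2. pose proof PI_RGT_0 as HPI.
  set (n := 1 + a ^ 2). set (r := sqrt n).
  assert (Hn : 9 / 8 <= n <= 9 / 8 + / 10 ^ 12) by (unfold n; lra).
  assert (Hr : 0 < r) by (apply sqrt_lt_R0; lra).
  assert (Hrr : r * r = n) by (apply sqrt_sqrt; lra).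
  set (c := 2 / (3 * n * r) / 6000). set (d := / 6000 ^ 2 / 500).
  pose proof (is_RInt_scal _ _ _ (a / r) _ (RInt_quadratic_sin c d)) as HI.
  apply Rle_lt_trans with (a / r * (2 * PI - d * PI)).
  - change (scal (a / r) (2 * PI - d * PI)) with (a / r * (2 * PI - d * PI)) in HI.
    rewrite <- (is_RInt_unique _ _ _ _ HI). apply RInt_le.
    + lra.
    + apply ex_RInt_comp_sin. intros; now apply continuous_rate.
    + eexists; apply HI.
    + intros x _. eapply Rle_trans.
      * apply rate_le; auto. pose proof (SIN_bound x). lra.
      * apply Req_le. fold n r. change (@scal R_AbsRing R_ModuleSpace) with Rmult.
        unfold scal; cbn. unfold mult; cbn. f_equal. unfold c, d. field. split; lra.
  - replace (2 * PI - d * PI) with (2 * PI * (1 - d / 2)) by field.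
    assert (Har : a / r * (1 - d / 2) < 1 / 3).
    { set (k := 1 - d / 2).
      (* d/2 = 1 / (36 * 10^9) exceeds 27 / 10^12. Thus 9 a^2 drops by at least 30 / 10^12, whereas
         it exceeds 1 + a^2 by at most 8 / 10^12. *)
      assert (Hk : 0 < k <= 1 - 27 / 10 ^ 12) by (unfold k, d; lra).
      assert (3 * a * k < r).
      { apply Rsqr_incrst_0; [|nra|lra]. unfold Rsqr.
        replace (3 * a * k * (3 * a * k)) with (9 * a ^ 2 * k ^ 2) by ring. rewrite Hrr.
        assert (k ^ 2 <= 1 - 27 / 10 ^ 12) by nra.
        unfold n. nra. }
      apply Rmult_lt_reg_r with r; auto.
      replace (a / r * k * r) with (a * k) by (field; lra). lra. }
    nra.
Qed.

(** * Closed orbits *)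

Lemma closing_amplitude a g : 0 < a -> amp_inverse a g -> a ^ 2 <= 1 / 8 + / 10 ^ 12 ->
  exists B, 0 < B /\ period a g B = 2 * PI / 3.
Proof.
  intros Ha Hg Ha2. pose proof PI_RGT_0 as HPI.
  assert (H0 : exists B, 0 <= B /\ period a g B < 2 * PI / 3).
  { destruct (Rlt_le_dec (a ^ 2) (1 / 8)) as [H|H].
    - exists 0. split; [lra|]. rewrite period_0 by exact Hg.
      assert (Hn : 0 < 1 + a ^ 2) by (pose proof (pow2_ge_0 a); lra).
      pose proof (sqrt_lt_R0 _ Hn) as Hr. pose proof (sqrt_sqrt _ (Rlt_le _ _ Hn)) as Hrr.
      set (r := sqrt (1 + a ^ 2)) in *.
      assert (3 * a < r) by nra.
      assert (a / r < 1 / 3).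
      { apply Rmult_lt_reg_r with r; auto. replace (a / r * r) with a by (field; lra). lra. }
      nra.
    - exists (1 / 6000). split; [lra|]. now apply period_small. }
  destruct H0 as (B0 & HB0 & Hsmall).
  destruct (period_large a g Ha Hg) as (Z & HZ).
  set (B1 := Rmax Z (B0 + 1)).
  assert (HB1 : B0 < B1) by (unfold B1; pose proof (Rmax_r Z (B0 + 1)); lra).
  assert (Hlarge : 2 * PI / 3 < period a g B1) by (apply HZ, Rmax_l).
  destruct (IVT_gen (period a g) B0 B1 (2 * PI / 3)) as (B & HB & E).
  - apply (continuity_RInt_comp_sin (rate a g)). intros; now apply continuous_rate.
  - rewrite Rmin_left, Rmax_right; lra.
  - rewrite Rmin_left, Rmax_right in HB by lra. exists B. split; auto.
    (* [B0] may be 0; B = B0 is impossible since the turning angle there is strictly below the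
       target, so B > 0. *)
    destruct (Req_dec B B0) as [->|]; lra.
Qed.

Lemma is_derive_RInt_comp_sin (f : R -> R) B x : (forall z, continuous f z) ->
  is_derive (fun x => RInt (fun phi => f (B * sin phi)) 0 x) x (f (B * sin x)).
Proof.
  intros Hf.
  apply (@is_derive_RInt R_NormedModule (fun phi => f (B * sin phi)) _ 0).
  - apply filter_forall. intros y.
    apply (@RInt_correct R_CompleteNormedModule), ex_RInt_comp_sin, Hf.
  - now apply continuous_comp_sin.
Qed.

(** By periodicity of sine, F (t + 2 PI) - F t has zero derivative, so it equals its value at t =
    0. *)
Lemma RInt_comp_sin_shift (f : R -> R) B x : (forall z, continuous f z) ->
  RInt (fun phi => f (B * sin phi)) 0 (x + 2 * PI) =
  RInt (fun phi => f (B * sin phi)) 0 x + RInt (fun phi => f (B * sin phi)) 0 (2 * PI).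
Proof.
  intros Hf.
  set (F := fun x => RInt (fun phi => f (B * sin phi)) 0 x).
  assert (HF : forall x, is_derive F x (f (B * sin x))) by (intros; now apply is_derive_RInt_comp_sin).
  assert (Hc : forall t, is_derive (fun t => F (t + 2 * PI) - F t) t zero).
  { intros t. evar_last.
    - apply (@is_derive_minus R_AbsRing R_NormedModule (fun t => F (t + 2 * PI)) F).
      + apply (is_derive_comp F (fun t => t + 2 * PI)); [apply HF|].
        auto_derive; [auto | reflexivity].
      + apply HF.
    - rewrite sin_plus, cos_2PI, sin_2PI. unfold minus, plus, opp, scal, zero; cbn. unfold mult; cbn.
      replace (sin t * 1 + cos t * 0) with (sin t) by ring. ring. }
  assert (F0 : F 0 = 0) by apply (@RInt_point R_CompleteNormedModule).
  assert (H : F (x + 2 * PI) - F x = F (0 + 2 * PI) - F 0).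
  { destruct (Rtotal_order x 0) as [H|[->|H]]; auto.
    - apply (eq_is_derive (fun t => F (t + 2 * PI) - F t)); auto.
    - symmetry. apply (eq_is_derive (fun t => F (t + 2 * PI) - F t)); auto. }
  rewrite F0, Rplus_0_l in H. fold (F (x + 2 * PI)) (F x) (F (2 * PI)). lra.
Qed.

(** The values at n T and - n T are n l and - n l, which eventually enclose any y. *)
Lemma surjective_of_shift (F : R -> R) (T l : R) : continuity F -> F 0 = 0 -> 0 < l ->
  (forall x, F (x + T) = F x + l) -> forall y, exists x, F x = y.
Proof.
  intros Hc H0 Hl Hs y.
  assert (Hn : forall n, F (INR n * T) = INR n * l /\ F (- (INR n * T)) = - (INR n * l)).
  { induction n as [|n [IH1 IH2]].
    - cbn. rewrite !Rmult_0_l, Ropp_0, H0. lra.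
    - rewrite S_INR. split.
      + replace ((INR n + 1) * T) with (INR n * T + T) by ring. rewrite Hs, IH1. ring.
      + pose proof (Hs (- ((INR n + 1) * T))) as E.
        replace (- ((INR n + 1) * T) + T) with (- (INR n * T)) in E by ring. lra. }
  destruct (nfloor_ex (Rabs y / l)) as [n [_ Hy]].
  { apply Rdiv_le_0_compat; [apply Rabs_pos | exact Hl]. }
  destruct (Hn (S n)) as [Hp Hm]. rewrite <- S_INR in Hy.
  apply (Rmult_lt_compat_r l) in Hy; auto.
  replace (Rabs y / l * l) with (Rabs y) in Hy by (field; lra).
  pose proof (Rle_abs y). pose proof (Rle_abs (- y)) as Hy'. rewrite Rabs_Ropp in Hy'.
  destruct (IVT_gen F (- (INR (S n) * T)) (INR (S n) * T) y Hc) as [x [_ Hx]]; [|eauto].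
  rewrite Hp, Hm, Rmin_left, Rmax_right; lra.
Qed.

Definition orbit (lambda : R) (k p th : R -> R) : Prop :=
  forall s, 0 < k s /\ is_derive k s (p s * k s) /\
    is_derive p s (1 + lambda * k s - k s ^ 2) /\ is_derive th s (k s).

(** The phase is the first parameter: [S] is arc length and [Th] the tangent angle as functions of
    it, and inverting [S] passes to arc length. One oscillation has length [l], and the closing
    amplitude makes it turn the tangent by 2 PI / 3. *)
Lemma orbit_exists a : 0 < a -> a ^ 2 <= 1 / 8 + / 10 ^ 12 ->
  exists k p th l, orbit (a - / a) k p th /\ 0 < l /\ (exists s, p s <> 0) /\
    forall s, k (s + l) = k s /\ p (s + l) = p s /\ th (s + l) = th s + 2 * PI / 3.
Proof.
  intros Ha Ha2. pose proof PI_RGT_0 as HPI.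
  destruct (amp_inverse_exists a Ha) as [g Hg].
  destruct (closing_amplitude a g Ha Hg Ha2) as (B & HB & HT).
  set (speed := fun z => / amp' a (g z)).
  assert (Hsp : forall z, continuous speed z) by (intros; now apply continuous_inv_amp').
  assert (Hpos : forall z, 0 < speed z) by (intros; apply Rinv_0_lt_compat, amp'_pos).
  assert (Hra : forall z, continuous (rate a g) z) by (intros; now apply continuous_rate).
  set (S := fun x => RInt (fun phi => speed (B * sin phi)) 0 x).
  set (Th := fun x => RInt (fun phi => rate a g (B * sin phi)) 0 x).
  assert (HS : forall x, is_derive S x (speed (B * sin x))) by (intros; now apply is_derive_RInt_comp_sin).
  assert (HTh : forall x, is_derive Th x (rate a g (B * sin x))) by (intros; now apply is_derive_RInt_comp_sin).
  set (l := S (2 * PI)).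
  assert (HSs : forall x, S (x + 2 * PI) = S x + l) by (intros; now apply RInt_comp_sin_shift).
  assert (HThs : forall x, Th (x + 2 * PI) = Th x + 2 * PI / 3).
  { intros. rewrite <- HT. now apply RInt_comp_sin_shift. }
  assert (S0 : S 0 = 0) by apply (@RInt_point R_CompleteNormedModule).
  assert (Hl : 0 < l).
  { unfold l. rewrite <- S0.
    apply (increasing_of_derive S (fun x => speed (B * sin x))); auto. lra. }
  destruct (inverse_derive S (fun x => speed (B * sin x))) as (phi & H1 & H2 & H3); auto.
  { apply surjective_of_shift with (2 * PI) l; auto. intros x.
    apply continuity_pt_filterlim, (ex_derive_continuous S). eexists; apply HS. }
  assert (Hphi : forall s, phi (s + l) = phi s + 2 * PI).
  { intros s. rewrite <- (H2 (phi s + 2 * PI)), HSs, H1. reflexivity. }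
  assert (Hdphi : forall s, is_derive phi s (amp' a (g (B * sin (phi s))))).
  { intros s. rewrite <- (Rinv_inv (amp' a (g (B * sin (phi s))))). apply H3. }
  exists (fun s => a * exp (g (B * sin (phi s)))), (fun s => B * cos (phi s)), (fun s => Th (phi s)), l.
  split; [|split; [exact Hl|split]].
  - intros s. pose proof (exp_pos (g (B * sin (phi s)))) as Hexp.
    pose proof (amp'_pos a (g (B * sin (phi s)))) as Ham.
    split; [|split; [|split]].
    + nra.
    + evar_last.
      * apply (is_derive_comp (fun z => a * exp (g z)) (fun s => B * sin (phi s)) s).
        -- apply (is_derive_scal (fun z => exp (g z))).
           apply (is_derive_comp exp g); [apply is_derive_exp | apply Hg].
        -- apply (is_derive_scal (fun s => sin (phi s))).
           apply (is_derive_comp sin phi); [apply is_derive_sin | apply Hdphi].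
      * unfold scal; cbn. unfold mult; cbn. field. lra.
    + evar_last.
      * apply (is_derive_scal (fun s => cos (phi s))).
        apply (is_derive_comp cos phi); [apply is_derive_cos | apply Hdphi].
      * unfold scal; cbn. unfold mult; cbn.
        (* With k = a e^u, (e^u - 1)(1 + a^2 e^u) = - (1 + (a - 1/a) k - k^2). *)
        pose proof (amp_amp' a (g (B * sin (phi s)))) as E. rewrite (proj1 Hg) in E.
        transitivity (- (B * sin (phi s) * amp' a (g (B * sin (phi s))))); [ring|].
        rewrite E. field. lra.
    + evar_last.
      * apply (is_derive_comp Th phi); [apply HTh | apply Hdphi].
      * unfold scal; cbn. unfold mult; cbn. unfold rate. field. lra.
  - exists 0. replace (phi 0) with 0 by (rewrite <- S0 at 2; now rewrite H2).
    rewrite cos_0. lra.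
  - intros s. rewrite Hphi, HThs, sin_plus, cos_plus, cos_2PI, sin_2PI.
    repeat split; repeat f_equal; ring.
Qed.

(** * The curve *)

(** A class of functions containing the coordinates of the curve and closed under differentiation
    along an orbit, so that smoothness follows by induction on the order. *)
Inductive poly_expr (k p th : R -> R) : (R -> R) -> Prop :=
| poly_const c : poly_expr k p th (fun _ => c)
| poly_k : poly_expr k p th k
| poly_p : poly_expr k p th p
| poly_cos : poly_expr k p th (fun s => cos (th s))
| poly_sin : poly_expr k p th (fun s => sin (th s))
| poly_plus f g : poly_expr k p th f -> poly_expr k p th g ->
    poly_expr k p th (fun s => f s + g s)
| poly_mult f g : poly_expr k p th f -> poly_expr k p th g ->
    poly_expr k p th (fun s => f s * g s).

Lemma poly_expr_derive lambda k p th f : orbit lambda k p th -> poly_expr k p th f ->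
  exists f', poly_expr k p th f' /\ forall s, is_derive f s (f' s).
Proof.
  intros Ho Hf. induction Hf as [c| | | | |f g Hf (f' & Hf' & Df) Hg (g' & Hg' & Dg)
    |f g Hf (f' & Hf' & Df) Hg (g' & Hg' & Dg)].
  - exists (fun _ => 0). split; [constructor|]. intros s. apply (@is_derive_const R_AbsRing).
  - exists (fun s => p s * k s). split; [repeat constructor|]. intros s; apply Ho.
  - exists (fun s => (1 + lambda * k s) + (-1) * (k s * k s)). split.
    + repeat apply poly_plus; repeat apply poly_mult; constructor.
    + intros s. evar_last; [apply Ho | cbn; ring].
  - exists (fun s => -1 * (k s * sin (th s))). split.
    + repeat apply poly_mult; constructor.
    + intros s. evar_last.
      * apply (is_derive_comp cos th); [apply is_derive_cos | apply Ho].
      * unfold scal; cbn. unfold mult; cbn. ring.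
  - exists (fun s => k s * cos (th s)). split.
    + repeat apply poly_mult; constructor.
    + intros s. apply (is_derive_comp sin th); [apply is_derive_sin | apply Ho].
  - exists (fun s => f' s + g' s). split; [now constructor|].
    intros s. now apply (@is_derive_plus R_AbsRing R_NormedModule).
  - exists (fun s => f' s * g s + f s * g' s). split; [now repeat constructor|].
    intros s. apply (is_derive_mult f g); auto. intros; apply Rmult_comm.
Qed.

Lemma poly_expr_smooth lambda k p th f n s : orbit lambda k p th -> poly_expr k p th f ->
  ex_derive_n f n s.
Proof.
  intros Ho Hf.
  assert (H : forall n, exists fn, poly_expr k p th fn /\ forall s, Derive_n f n s = fn s).
  { clear n s. induction n as [|n (fn & Hfn & E)]; [now exists f|].
    destruct (poly_expr_derive lambda k p th fn Ho Hfn) as (fn' & Hfn' & D).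
    exists fn'. split; auto. intros s. cbn. rewrite (Derive_ext _ fn) by exact E.
    now apply is_derive_unique. }
  destruct n as [|n]; [exact I|]. cbn.
  destruct (H n) as (fn & Hfn & E).
  destruct (poly_expr_derive lambda k p th fn Ho Hfn) as (fn' & _ & D).
  apply ex_derive_ext with fn; [intros; symmetry; apply E|]. exists (fn' s). apply D.
Qed.

(* The equation forces <x, N> = lambda - k, and differentiating this gives <x, T> = k' / k = p. *)
Definition curve (lambda : R) (k p th : R -> R) (s : R) : plane :=
  (p s * cos (th s) - (lambda - k s) * sin (th s),
   p s * sin (th s) + (lambda - k s) * cos (th s)).

Lemma is_derive_curve lambda k p th s : orbit lambda k p th ->
  is_derive (fun t => fst (curve lambda k p th t)) s (cos (th s)) /\
  is_derive (fun t => snd (curve lambda k p th t)) s (sin (th s)).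
Proof.
  intros Ho. destruct (Ho s) as (_ & Hk & Hp & Hth).
  assert (ex_derive k s) by (eexists; apply Hk).
  assert (ex_derive p s) by (eexists; apply Hp).
  assert (ex_derive th s) by (eexists; apply Hth).
  pose proof (is_derive_unique _ _ _ Hk) as Ek. pose proof (is_derive_unique _ _ _ Hp) as Ep.
  pose proof (is_derive_unique _ _ _ Hth) as Et.
  unfold curve; cbn. split; auto_derive; auto;
    change (Derive (fun x => k x)) with (Derive k); change (Derive (fun x => p x)) with (Derive p);
    change (Derive (fun x => th x)) with (Derive th); rewrite Ek, Ep, Et; ring.
Qed.

Lemma deriv_curve lambda k p th s : orbit lambda k p th ->
  deriv (curve lambda k p th) s = (cos (th s), sin (th s)).
Proof.
  intros Ho. unfold deriv. destruct (is_derive_curve lambda k p th s Ho) as [Hx Hy].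
  f_equal; now apply is_derive_unique.
Qed.

Lemma deriv_deriv_curve lambda k p th s : orbit lambda k p th ->
  deriv (deriv (curve lambda k p th)) s = (- (k s * sin (th s)), k s * cos (th s)).
Proof.
  intros Ho. unfold deriv at 1. destruct (Ho s) as (_ & _ & _ & Hth). f_equal.
  - rewrite (Derive_ext _ (fun s => cos (th s))) by (intros; now rewrite deriv_curve).
    apply is_derive_unique. evar_last.
    + apply (is_derive_comp cos th); [apply is_derive_cos | apply Hth].
    + unfold scal; cbn. unfold mult; cbn. ring.
  - rewrite (Derive_ext _ (fun s => sin (th s))) by (intros; now rewrite deriv_curve).
    apply is_derive_unique. apply (is_derive_comp sin th); [apply is_derive_sin | apply Hth].
Qed.

Lemma enorm_eq x y : enorm (x, y) = sqrt (x ^ 2 + y ^ 2).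
Proof.
  unfold enorm, norm; cbn. unfold prod_norm; cbn. f_equal. unfold norm; cbn.
  unfold abs; cbn. rewrite !Rmult_1_r. rewrite <- !Rabs_mult.
  rewrite !Rabs_pos_eq; auto; nra.
Qed.

Lemma enorm_cos_sin t : enorm (cos t, sin t) = 1.
Proof.
  rewrite enorm_eq, <- sqrt_1. f_equal. pose proof (sin2_cos2 t) as H. unfold Rsqr in H. lra.
Qed.

Lemma curve_solution lambda k p th : orbit lambda k p th ->
  is_solution lambda (curve lambda k p th).
Proof.
  intros Ho. split.
  - intros s. rewrite deriv_curve by exact Ho. apply enorm_cos_sin.
  - exists (fun s => (- sin (th s), cos (th s))), k. split; [|split].
    + left. intros s. rewrite deriv_curve by exact Ho.
      unfold rot; cbn. rewrite cos_PI2, sin_PI2. f_equal; ring.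
    + intros s. rewrite (deriv_deriv_curve lambda) by exact Ho. cbn. f_equal; ring.
    + intros s. unfold dot, curve; cbn.
      pose proof (sin2_cos2 (th s)) as H. unfold Rsqr in H.
      transitivity (- ((lambda - k s) * (sin (th s) * sin (th s) + cos (th s) * cos (th s))) + lambda);
        [rewrite H; ring | ring].
Qed.

Lemma curve_smooth lambda k p th : orbit lambda k p th -> smooth (curve lambda k p th).
Proof.
  intros Ho n s. split; cbn.
  - apply ex_derive_n_ext with
      (fun s => p s * cos (th s) + (-1 * (lambda + -1 * k s)) * sin (th s)).
    + intros t. ring.
    + apply (poly_expr_smooth lambda k p th); auto.
      repeat (apply poly_plus || apply poly_mult || constructor).
  - apply ex_derive_n_ext with (fun s => p s * sin (th s) + (lambda + -1 * k s) * cos (th s)).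
    + intros t. ring.
    + apply (poly_expr_smooth lambda k p th); auto.
      repeat (apply poly_plus || apply poly_mult || constructor).
Qed.

Lemma curve_regular lambda k p th : orbit lambda k p th -> regular (curve lambda k p th).
Proof.
  intros Ho s E. rewrite deriv_curve in E by exact Ho. injection E as Ec Es.
  pose proof (sin2_cos2 (th s)) as H. unfold Rsqr in H. rewrite Ec, Es in H. lra.
Qed.

(* On one turn the height over the tangent line at s first increases and then decreases back to 0. *)
Lemma curve_injective lambda k p th s t L : orbit lambda k p th ->
  th (s + L) = th s + 2 * PI -> curve lambda k p th (s + L) = curve lambda k p th s ->
  s < t < s + L -> curve lambda k p th t <> curve lambda k p th s.
Proof.
  intros Ho HthL HxL Ht E.
  set (x := curve lambda k p th) in *.
  set (X := fun u => fst (x u)). set (Y := fun u => snd (x u)).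
  set (f := fun u => (Y u - Y s) * cos (th s) - (X u - X s) * sin (th s)).
  (* The height over the tangent line at s changes at the sine of the angle turned since s. *)
  set (df := fun u => sin (th u - th s)).
  assert (Hd : forall u, is_derive f u (df u)).
  { intros u. destruct (is_derive_curve lambda k p th u Ho) as [Hx Hy].
    change (is_derive X u (cos (th u))) in Hx. change (is_derive Y u (sin (th u))) in Hy.
    unfold f, df. rewrite sin_minus.
    assert (ex_derive X u) by (eexists; apply Hx).
    assert (ex_derive Y u) by (eexists; apply Hy).
    auto_derive; [auto|].
    change (Derive (fun x => X x)) with (Derive X). change (Derive (fun x => Y x)) with (Derive Y).
    rewrite (is_derive_unique _ _ _ Hx), (is_derive_unique _ _ _ Hy). ring. }
  assert (Hc : forall u, continuity_pt f u).
  { intros u. apply continuity_pt_filterlim, (ex_derive_continuous f). eexists; apply Hd. }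
  assert (Hth : forall u v, u < v -> th u < th v).
  { apply (increasing_of_derive th k); intros; apply Ho. }
  assert (f0 : f s = 0) by (unfold f; ring).
  assert (ft : f t = 0) by (unfold f, X, Y; rewrite E; ring).
  assert (fL : f (s + L) = 0) by (unfold f, X, Y; rewrite HxL; ring).
  pose proof PI_RGT_0 as HPI.
  (* Rolle's theorem on [s, t] and on [t, s + L] puts the angle PI strictly on both sides of t. *)
  destruct (Rolle f s t (fun u _ => ex_derive_Reals_0 f u (ex_intro _ _ (Hd u))) (fun u _ => Hc u))
    as (u & Hu & Eu); [lra|lra|].
  destruct (Rolle f t (s + L) (fun u _ => ex_derive_Reals_0 f u (ex_intro _ _ (Hd u))) (fun u _ => Hc u))
    as (v & Hv & Ev); [lra|lra|].
  assert (HD : forall w, Derive f w = sin (th w - th s)) by (intros; now apply is_derive_unique).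
  rewrite Derive_Reals, HD in Eu. rewrite Derive_Reals, HD in Ev.
  (* Strictly inside the turn the angle lies in (0, 2 PI), where sine vanishes only at PI. *)
  assert (Hpi : forall w, s < w < s + L -> sin (th w - th s) = 0 -> th w - th s = PI).
  { intros w Hw Ew. pose proof (Hth s w ltac:(lra)). pose proof (Hth w (s + L) ltac:(lra)).
    destruct (Rtotal_order (th w - th s) PI) as [H1|[H1|H1]]; auto.
    - pose proof (sin_gt_0 (th w - th s) ltac:(lra) H1). lra.
    - pose proof (sin_lt_0 (th w - th s) H1 ltac:(lra)). lra. }
  apply Hpi in Eu; [|lra]. apply Hpi in Ev; [|lra].
  pose proof (Hth u v ltac:(lra)). lra.
Qed.

(** Differentiating the constant squared distance to the centre twice gives <x - c, T> = 0 and 1 + k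
    <x - c, N> = 0. Hence k is the constant 1 / r, and k' = p k forces p = 0 everywhere. *)
Lemma curve_not_circle lambda k p th : orbit lambda k p th -> (exists s, p s <> 0) ->
  ~ is_circle (image (curve lambda k p th)).
Proof.
  intros Ho [s0 Hs0] ([cx cy] & r & Hr & Hcirc). apply Hs0.
  set (x := curve lambda k p th) in *.
  set (X := fun s => fst (x s) - cx). set (Y := fun s => snd (x s) - cy).
  assert (HX : forall s, is_derive X s (cos (th s)) /\ is_derive Y s (sin (th s))).
  { intros s. destruct (is_derive_curve lambda k p th s Ho) as [Hx Hy]. fold x in Hx, Hy.
    unfold X, Y. split; evar_last;
      [apply (@is_derive_minus R_AbsRing R_NormedModule); [apply Hx | apply is_derive_const] | |
       apply (@is_derive_minus R_AbsRing R_NormedModule); [apply Hy | apply is_derive_const] |];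
      apply Rminus_0_r. }
  assert (Hnorm : forall s, X s * X s + Y s * Y s = r ^ 2).
  { intros s. assert (H : image x (x s)) by now exists s.
    apply Hcirc in H. rewrite enorm_eq in H. change (sqrt (X s ^ 2 + Y s ^ 2) = r) in H.
    rewrite <- H, pow2_sqrt; [ring|]. pose proof (pow2_ge_0 (X s)). pose proof (pow2_ge_0 (Y s)). lra. }
  assert (HT : forall s, X s * cos (th s) + Y s * sin (th s) = 0).
  { intros s. destruct (HX s) as [DX DY].
    assert (D : is_derive (fun s => X s * X s + Y s * Y s) s
      (2 * (X s * cos (th s) + Y s * sin (th s)))).
    { evar_last.
      - apply (@is_derive_plus R_AbsRing R_NormedModule).
        + apply (is_derive_mult X X); [apply DX | apply DX | intros; apply Rmult_comm].
        + apply (is_derive_mult Y Y); [apply DY | apply DY | intros; apply Rmult_comm].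
      - unfold plus, mult; cbn. ring. }
    apply (is_derive_ext _ (fun _ => r ^ 2)) in D; [|exact Hnorm].
    apply is_derive_unique in D. rewrite Derive_const in D. lra. }
  assert (HN : forall s, 1 + k s * (Y s * cos (th s) - X s * sin (th s)) = 0).
  { intros s. destruct (HX s) as [DX DY]. destruct (Ho s) as (_ & _ & _ & Dth).
    assert (D : is_derive (fun s => X s * cos (th s) + Y s * sin (th s)) s
      (1 + k s * (Y s * cos (th s) - X s * sin (th s)))).
    { evar_last.
      - apply (@is_derive_plus R_AbsRing R_NormedModule).
        + apply (is_derive_mult X (fun s => cos (th s))); [apply DX | | intros; apply Rmult_comm].
          apply (is_derive_comp cos th); [apply is_derive_cos | apply Dth].
        + apply (is_derive_mult Y (fun s => sin (th s))); [apply DY | | intros; apply Rmult_comm].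
          apply (is_derive_comp sin th); [apply is_derive_sin | apply Dth].
      - unfold plus, mult, scal; cbn. unfold mult; cbn.
        pose proof (sin2_cos2 (th s)) as H. unfold Rsqr in H. lra. }
    apply (is_derive_ext _ (fun _ => 0)) in D; [|exact HT].
    apply is_derive_unique in D. rewrite Derive_const in D. lra. }
  assert (Hk : forall s, k s = / r).
  { intros s. specialize (HN s). specialize (HT s). specialize (Hnorm s).
    pose proof (sin2_cos2 (th s)) as H. unfold Rsqr in H.
    set (m := Y s * cos (th s) - X s * sin (th s)) in *.
    assert (Hm : m ^ 2 = r ^ 2).
    { rewrite <- Hnorm.
      replace (X s * X s + Y s * Y s) with
        ((X s * X s + Y s * Y s) * (sin (th s) * sin (th s) + cos (th s) * cos (th s)))
        by (rewrite H; ring).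
      transitivity (m ^ 2 + (X s * cos (th s) + Y s * sin (th s)) ^ 2); [rewrite HT; ring|].
      unfold m. ring. }
    destruct (Ho s) as (Hk0 & _).
    (* Of the two roots of m^2 = r^2, the relation 1 + k m = 0 with k > 0 selects m = - r. *)
    assert (Hm0 : m < 0) by nra.
    assert (m = - r).
    { assert (Hf : (m - r) * (m + r) = 0) by (ring_simplify; lra).
      apply Rmult_integral in Hf. lra. }
    apply (Rmult_eq_reg_r r); [|lra]. rewrite Rinv_l by lra. nra. }
  destruct (Ho s0) as (Hk0 & Dk & _).
  apply (is_derive_ext _ (fun _ => / r)) in Dk; [|exact Hk].
  apply is_derive_unique in Dk. rewrite Derive_const in Dk. nra.
Qed.

(** * Threefold symmetry and the choice of [delta] *)

Lemma rot_injective t p q : rot t p = rot t q -> p = q.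
Proof.
  destruct p as [x y], q as [x' y']. unfold rot; cbn. intros E. injection E as E1 E2.
  pose proof (sin2_cos2 t) as H. unfold Rsqr in H.
  f_equal.
  - transitivity ((sin t * sin t + cos t * cos t) * x); [rewrite H; ring|].
    transitivity (cos t * (cos t * x - sin t * y) + sin t * (sin t * x + cos t * y)); [ring|].
    rewrite E1, E2. transitivity ((sin t * sin t + cos t * cos t) * x'); [ring | rewrite H; ring].
  - transitivity ((sin t * sin t + cos t * cos t) * y); [rewrite H; ring|].
    transitivity (cos t * (sin t * x + cos t * y) - sin t * (cos t * x - sin t * y)); [ring|].
    rewrite E1, E2. transitivity ((sin t * sin t + cos t * cos t) * y'); [ring | rewrite H; ring].
Qed.

(** The coordinates [p] and [lambda - k] in the moving frame are l-periodic while the frame turns by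
    2 PI / 3, so the shift by l acts as that rotation, and three shifts close the curve after one
    full turn. *)
Lemma three_fold_curve a : 0 < a -> a ^ 2 <= 1 / 8 + / 10 ^ 12 ->
  exists x, closed_embedded x /\ ~ is_circle (image x) /\ is_solution (a - / a) x /\
    admits_symmetry 3 (image x).
Proof.
  intros Ha Ha2.
  destruct (orbit_exists a Ha Ha2) as (k & p & th & l & Ho & Hl & Hp & Hper).
  set (x := curve (a - / a) k p th).
  assert (Hrot : forall s, x (s + l) = rot (2 * PI / 3) (x s)).
  { intros s. unfold x, curve, rot; cbn. destruct (Hper s) as (-> & -> & ->).
    rewrite sin_plus, cos_plus. f_equal; ring. }
  assert (H3 : forall s, x (s + 3 * l) = x s /\ th (s + 3 * l) = th s + 2 * PI).
  { intros s. replace (s + 3 * l) with (s + l + l + l) by ring.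
    destruct (Hper s) as (E1 & E2 & E3), (Hper (s + l)) as (F1 & F2 & F3), (Hper (s + l + l)) as (G1 & G2 & G3).
    assert (E : th (s + l + l + l) = th s + 2 * PI) by lra.
    split; auto. unfold x, curve. rewrite E, G1, F1, E1, G2, F2, E2, sin_plus, cos_plus, cos_2PI, sin_2PI.
    f_equal; ring. }
  exists x. split; [|split; [|split]].
  - split; [now apply curve_smooth|]. split; [now apply curve_regular|].
    exists (3 * l). split.
    + split; [lra|]. intros s; apply H3.
    + intros s t Hs Ht E. destruct (Rtotal_order s t) as [H|[H|H]]; auto; exfalso.
      * apply (curve_injective (a - / a) k p th s t (3 * l)); auto; try apply H3. lra.
      * apply (curve_injective (a - / a) k p th t s (3 * l)); auto; try apply H3. lra.
  - now apply curve_not_circle.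
  - now apply curve_solution.
  - split; [lia|]. replace (2 * PI / INR 3) with (2 * PI / 3) by (cbn; f_equal; ring).
    intros q. split.
    + intros [s <-]. exists (s + l). apply Hrot.
    + intros [s E]. exists (s - l). apply (rot_injective (2 * PI / 3)).
      rewrite <- E, <- Hrot. f_equal. ring.
Qed.

(** The witness is the positive root of a^2 - lambda a - 1 = 0. *)
Lemma exists_radius_parameter lambda : exists a, 0 < a /\ a - / a = lambda.
Proof.
  set (d := sqrt (lambda ^ 2 + 4)).
  assert (Hd : d * d = lambda ^ 2 + 4) by (apply sqrt_sqrt; pose proof (pow2_ge_0 lambda); lra).
  assert (Hd0 : 0 <= d) by apply sqrt_pos.
  exists ((lambda + d) / 2). assert (0 < lambda + d) by nra.
  split; [lra|]. field_simplify_eq; [|lra]. nra.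
Qed.

Theorem theorem1p3 :
  exists delta : R, 0 < delta /\
    forall lambda : R, lambda < - (7 / (2 * sqrt 2)) + delta ->
      exists (m : nat) (x : R -> plane),
        (2 < m)%nat /\
        closed_embedded x /\
        ~ is_circle (image x) /\
        is_solution lambda x /\
        admits_symmetry m (image x).
Proof.
  (* [a0] is the parameter of the threshold -7 / (2 sqrt 2), where a^2 = 1/8; [a1] is the largest
     parameter that [three_fold_curve] admits. *)
  set (a0 := / (2 * sqrt 2)). set (a1 := sqrt (1 / 8 + / 10 ^ 12)).
  assert (Hs : 0 < sqrt 2) by (apply sqrt_lt_R0; lra).
  pose proof (sqrt_sqrt 2 ltac:(lra)) as Hss.
  assert (Ha0 : 0 < a0) by (apply Rinv_0_lt_compat; lra).
  assert (Ha1 : 0 < a1) by (apply sqrt_lt_R0; lra).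
  assert (E0 : a0 * a0 = 1 / 8).
  { unfold a0. rewrite <- Rinv_mult. replace (2 * sqrt 2 * (2 * sqrt 2)) with 8 by lra. lra. }
  assert (E1 : a1 * a1 = 1 / 8 + / 10 ^ 12) by (apply sqrt_sqrt; lra).
  assert (El : - (7 / (2 * sqrt 2)) = a0 - / a0).
  { unfold a0. rewrite Rinv_inv. field_simplify_eq; [|lra]. nra. }
  assert (Hinc : forall a b, 0 < a -> 0 < b -> a < b -> a - / a < b - / b).
  { intros a b H1 H2 H. pose proof (Rinv_lt_contravar a b ltac:(nra) H). lra. }
  (* Since a - 1/a increases on a > 0, lambda below the threshold plus this [delta] means exactly a
     < a1. *)
  exists ((a1 - / a1) - (a0 - / a0)). split.
  - pose proof (Hinc a0 a1 Ha0 Ha1 ltac:(nra)). lra.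
  - intros lambda Hl. rewrite El in Hl.
    destruct (exists_radius_parameter lambda) as (a & Ha & <-).
    assert (a <= a1).
    { apply Rnot_lt_le. intros H. pose proof (Hinc a1 a Ha1 Ha H). lra. }
    destruct (three_fold_curve a Ha) as [x Hx]; [nra|].
    exists 3%nat, x. split; [lia | exact Hx].
Qed.
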